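(* Let $p\in[2,\infty)$ and $N\ge1$. Let $\Phi$ be a $\mathbf{\Phi}$-function such that $\Phi\in(\mathrm{aInc})_p$. There are a positive universal numerical constant $c_1$ and a positive number $c_2=c_2(\Phi,p)$, depending only on $\Phi$ and $p$ (in particular not on $N$), such that for every compact $\Omega\subset\mathbb{R}^d$, every Borel probability measure $\mu$ on $\Omega$ and every $N$-dimensional subspace $X_N\subset C(\Omega)$, there is a set $\mathbf{x}=\{x_1,\dots,x_m\}\subset\Omega$ of cardinality $m\le c_1N$ for which $$\|f\|_\Phi\le c_2\Bigl(\frac{\Phi(\sqrt N)}{N}\Bigr)^{1/p}\|f\|_{2,\mathbf{x}}\quad\forall f\in X_N.$$ Moreover, one can take $c_2(\Phi,p)$ to be of the form $$c_2(\Phi,p)=C\,a_\Phi(p)^{2/p}\bigl(1+(\Phi(1))^{-1}\bigr)^{1/p},$$ where $C\ge1$ is a universal numerical constant.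
   Context: ''Increasing'' is meant in the non-strict sense. A $\mathbf{\Phi}$-function is an increasing function $\Phi:[0,\infty)\to[0,\infty)$ with $\Phi(0)=0$, $\lim_{t\to0+}\Phi(t)=0$, $\lim_{t\to\infty}\Phi(t)=\infty$ and $\Phi\in(\mathrm{aInc})_1$. $\Phi\in(\mathrm{aInc})_p$ means that $t\mapsto\Phi(t)t^{-p}$ is almost increasing on $(0,\infty)$: there is a constant $a_\Phi(p)\ge1$ with $\Phi(s)s^{-p}\le a_\Phi(p)\Phi(t)t^{-p}$ for all $0<s<t$. $C(\Omega)$ is the space of continuous (real- or complex-valued) functions on $\Omega$. $\|f\|_\Phi=\|f\|_{L^\Phi(\mu)}:=\inf\{\lambda>0:\int_\Omega\Phi(|f|/\lambda)\,d\mu\le1\}$ and $\|f\|_{2,\mathbf{x}}:=\bigl(\frac1m\sum_{j=1}^m|f(x_j)|^2\bigr)^{1/2}$.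
   Formalization: The bound is stated only for N with Φ(√N)>0 (and the explicit c_2 only when Φ(1)>0), since it fails when Φ(√N)=0; the sampling points x_1,…,x_m may be repeated, since with distinct points the claim fails for finite Ω. *)

(* Defs.v *)
From HB Require Import structures.
From mathcomp Require Import all_boot all_order all_algebra.
From mathcomp Require Import all_classical all_reals all_analysis.
From mathcomp Require Import complex.

Set Implicit Arguments.
Unset Strict Implicit.
Unset Printing Implicit Defensive.

Import Order.TTheory GRing.Theory Num.Theory.
Import numFieldNormedType.Exports.

Local Open Scope classical_set_scope.
Local Open Scope ring_scope.

(* Functions may be real- or complex-valued.  The norm of R[i] takes its values
   in R[i], whence the separate R-valued modulus. *)
Inductive scalar_kind := RealScalars | ComplexScalars.

Definition scalars (R : realType) (k : scalar_kind) : numFieldType :=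
  match k with RealScalars => R | ComplexScalars => R[i] end.

Definition modulus (R : realType) (k : scalar_kind) : scalars R k -> R :=
  match k return scalars R k -> R with
  | RealScalars => fun x : R => `|x|
  | ComplexScalars => fun z : R[i] => ComplexField.Normc.normc z
  end.

(* A function on [0, +oo[ is represented by a function on R whose values at
   negative reals play no role. *)
Definition aInc_with (R : realType) (Phi : R -> R) (p a : R) : Prop :=
  1 <= a /\
  forall s t : R, 0 < s -> s < t ->
    Phi s * s `^ (- p) <= a * (Phi t * t `^ (- p)).

Definition aInc (R : realType) (Phi : R -> R) (p : R) : Prop :=
  exists a : R, aInc_with Phi p a.

Record Phi_function (R : realType) (Phi : R -> R) : Prop := {
  Phi_ge0 : forall t : R, 0 <= t -> 0 <= Phi t;
  Phi_homo : forall s t : R, 0 <= s -> s <= t -> Phi s <= Phi t;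
  Phi_at0 : Phi 0 = 0;
  Phi_cvg0 : Phi t @[t --> (0 : R)^'+] --> (0 : R);
  Phi_cvgy : Phi t @[t --> +oo] --> +oo;
  Phi_aInc1 : aInc Phi 1
}.

Definition borelRd (R : realType) (d : nat) :=
  g_sigma_algebraType (@open 'rV[R]_d).

(* The infimum is taken in \bar R, so that it is +oo over the empty set (an
   infimum in R would be 0). *)
Definition luxemburg_norm (R : realType) (d : nat) (Omega : set 'rV[R]_d)
    (mu : {measure set (borelRd R d) -> \bar R}) (Phi : R -> R)
    (k : scalar_kind) (f : 'rV[R]_d -> scalars R k) : \bar R :=
  ereal_inf [set l%:E | l in [set l : R | 0 < l /\
    (\int[mu]_(x in Omega) (Phi (modulus (f x) / l))%:E <= 1)%E]].

Definition sample_norm2 (R : realType) (d : nat) (k : scalar_kind) (m : nat)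
    (x : 'I_m -> 'rV[R]_d) (f : 'rV[R]_d -> scalars R k) : R :=
  Num.sqrt (m%:R^-1 * \sum_(j < m) modulus (f (x j)) ^+ 2).

(* An element of C(Omega) is represented by any function on R^d that restricts
   to it; hence linear independence and the expansion of an element in a basis
   are only required on Omega. *)
Definition subspace_C_dim (R : realType) (d : nat) (k : scalar_kind)
    (Omega : set 'rV[R]_d) (N : nat) (X : set ('rV[R]_d -> scalars R k)) : Prop :=
  (forall f, X f -> {within Omega, continuous f}) /\
  exists e : 'I_N -> 'rV[R]_d -> scalars R k,
    (forall c : 'I_N -> scalars R k,
      (forall x, Omega x -> \sum_(i < N) c i * e i x = 0) ->
      forall i, c i = 0) /\
    (forall f, X f <->
      exists c : 'I_N -> scalars R k,
        forall x, Omega x -> f x = \sum_(i < N) c i * e i x).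

(* A Borel probability measure on Omega is represented by a Borel probability
   measure mu on R^d with mu Omega = 1.  The points x_1, ..., x_m may be
   repeated: for Omega of N points, X = C(Omega), mu > 0 at each point and
   >= 1/2 at one of them, and Phi t = t ^ p, distinct points force m = N and no
   c2 independent of N works. *)
Definition sampling_bound (R : realType) (Phi : R -> R) (p c1 c2 : R)
    (N : nat) : Prop :=
  forall (k : scalar_kind) (d : nat) (Omega : set 'rV[R]_d)
      (mu : probability (borelRd R d) R) (X : set ('rV[R]_d -> scalars R k)),
    compact Omega -> mu Omega = 1%E -> subspace_C_dim Omega N X ->
    exists (m : nat) (x : 'I_m -> 'rV[R]_d),
      [/\ (0 < m)%N, m%:R <= c1 * N%:R, (forall j, Omega (x j)) &
        forall f, X f ->
          (luxemburg_norm Omega mu Phi f <=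
            (c2 * (Phi (Num.sqrt N%:R) / N%:R) `^ p^-1 * sample_norm2 x f)%:E)%E].

(* Main.v *)
Require Import Defs.
From HB Require Import structures.
From mathcomp Require Import all_boot all_order all_algebra.
From mathcomp Require Import all_classical all_reals all_analysis.
From mathcomp Require Import complex perm ring lra measurable_realfun.

(** The whole statement reduces to an unweighted discretization of two norms at
once: for every [N]-dimensional [X] there are [m <= 7 N] points, possibly
repeated, such that [S f := sum_j |f (x_j)|^2] satisfies, for all [f] in [X],

  |f y|^2 <= S f  for all [y] in [Omega],  and  (N / 2) int |f|^2 dmu <= S f

([subspace_discretization]).  With [A] the sample norm of [f], so that
[S f = m A^2], the function [h = |f| / (4 A)] then has [h <= sqrt N] and
[int h^2 <= 1].  Since [p >= 2], the condition (aInc)_p gives, for [L >= 1],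

  Phi (h / L) <= a Phi (sqrt N) L^-p (h / sqrt N)^p
              <= a Phi (sqrt N) L^-p h^2 / N,

which integrates to at most 1 once [L^p >= a Phi (sqrt N) / N]
([Phi_modular_le1]); then the Luxemburg norm of [f] is at most [4 A L].  The two
requirements on [L] are met by the announced constant, because (aInc)_p with
[p >= 2] also bounds [Phi (sqrt N) / N] from below by a fixed positive number
([aInc_ratio]).

For the discretization, take first a real space of dimension [k] in coordinates:
[f y] is the dot product of a vector [u y] with the coordinates of [f], and the
claim is a comparison of positive definite matrices.

The first [3 k] points nearly maximize the determinant of their Gram matrix
[M = sum_j u_j u_j^T] (a D-optimal design).  The leverages [u_j^T M^-1 u_j] add up
to [k], so one of them is at most 1/3; if some [u y^T M^-1 u y] exceeded 1, then
exchanging that point for [y] would increase the determinant too much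
([exists_design]).  Hence [(f y)^2 <= sum_j f (x_j)^2] everywhere.

The other [N] points come from the lower barrier of Batson, Spielman and
Srivastava, with unit weights.  Let [G = int u u^T dmu].  The previous bound says
that the potential [tr (G M^-1)] is at most 1, and as long as a positive definite
[S] has potential at most 1, there is a point [y] for which
[S + u u^T - G / 2] is again positive definite with potential at most 1
([barrier_step]): the required inequality holds on average over [mu].  After [N]
steps, [M + sum_j u_j u_j^T] dominates [(N / 2) G].

A complex space is handled through the real space spanned by the real and
imaginary parts of a basis, which has dimension at most [2 N]; this is where
[7 N = 3 (2 N) + N] comes from. *)

Set Implicit Arguments.
Unset Strict Implicit.
Unset Printing Implicit Defensive.

Import Order.TTheory GRing.Theory Num.Theory.
Import numFieldNormedType.Exports.

Local Open Scope classical_set_scope.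
Local Open Scope ring_scope.

(** * Positive definite matrices *)

Definition bilin (R : pzRingType) k (A : 'M[R]_k) (x y : 'cV[R]_k) : R :=
  \tr (x^T *m A *m y).

Definition posdef (R : numDomainType) k (A : 'M[R]_k) : Prop :=
  A^T = A /\ forall x, x != 0 -> 0 < bilin A x x.

Lemma bilin_scalar (R : pzRingType) k (A : 'M[R]_k) x y :
  x^T *m A *m y = (bilin A x y)%:M.
Proof. by rewrite /bilin trace_mx11; apply: mx11_scalar. Qed.

Lemma bilinE (R : comPzRingType) k (A : 'M[R]_k) x y : bilin A x y = \tr (A *m (y *m x^T)).
Proof. by rewrite /bilin mulmxA [RHS]mxtrace_mulC !mulmxA. Qed.

Lemma bilinDm (R : comPzRingType) k (A B : 'M[R]_k) x y :
  bilin (A + B) x y = bilin A x y + bilin B x y.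
Proof. by rewrite !bilinE mulmxDl mxtraceD. Qed.

Lemma bilinNm (R : comPzRingType) k (A : 'M[R]_k) x y : bilin (- A) x y = - bilin A x y.
Proof. by rewrite !bilinE mulNmx raddfN. Qed.

Lemma bilinZm (R : comPzRingType) k a (A : 'M[R]_k) x y :
  bilin (a *: A) x y = a * bilin A x y.
Proof. by rewrite !bilinE -scalemxAl mxtraceZ. Qed.

Lemma bilinDl (R : comPzRingType) k (A : 'M[R]_k) x y z :
  bilin A (x + y) z = bilin A x z + bilin A y z.
Proof. by rewrite /bilin linearD /= !mulmxDl mxtraceD. Qed.

Lemma bilinDr (R : comPzRingType) k (A : 'M[R]_k) x y z :
  bilin A z (x + y) = bilin A z x + bilin A z y.
Proof. by rewrite /bilin mulmxDr mxtraceD. Qed.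

Lemma bilinZl (R : comPzRingType) k (A : 'M[R]_k) a x y :
  bilin A (a *: x) y = a * bilin A x y.
Proof. by rewrite /bilin linearZ /= -!scalemxAl mxtraceZ. Qed.

Lemma bilinZr (R : comPzRingType) k (A : 'M[R]_k) a x y :
  bilin A x (a *: y) = a * bilin A x y.
Proof. by rewrite /bilin -scalemxAr mxtraceZ. Qed.

Lemma bilinM (R : comPzRingType) k (A B C : 'M[R]_k) x y :
  bilin (B^T *m A *m C) x y = bilin A (B *m x) (C *m y).
Proof. by rewrite /bilin trmx_mul !mulmxA. Qed.

Lemma bilin_sym (R : comPzRingType) k (A : 'M[R]_k) x y :
  A^T = A -> bilin A x y = bilin A y x.
Proof.
by move=> Asym; rewrite /bilin -[LHS]mxtrace_tr !trmx_mul trmxK Asym mulmxA.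
Qed.

Lemma bilin_outer (R : comPzRingType) k (v x y : 'cV[R]_k) :
  bilin (v *m v^T) x y = \tr (x^T *m v) * \tr (v^T *m y).
Proof.
rewrite /bilin mulmxA -(mulmxA (x^T *m v)) {1}(mx11_scalar (x^T *m v)).
by rewrite mul_scalar_mx mxtraceZ -trace_mx11.
Qed.

Lemma dot_sym (R : comPzRingType) k (x y : 'cV[R]_k) : \tr (x^T *m y) = \tr (y^T *m x).
Proof. by rewrite -[LHS]mxtrace_tr trmx_mul trmxK. Qed.

Lemma bilin_outer_sq (R : comPzRingType) k (v x : 'cV[R]_k) :
  bilin (v *m v^T) x x = \tr (v^T *m x) ^+ 2.
Proof. by rewrite bilin_outer dot_sym. Qed.

Lemma posdef_ge0 (R : numDomainType) k (A : 'M[R]_k) x : posdef A -> 0 <= bilin A x x.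
Proof.
case=> _ Apos; have [->|/Apos/ltW//] := eqVneq x 0.
by rewrite /bilin mulmx0 mxtrace0.
Qed.

Lemma posdef_unit (R : numFieldType) k (A : 'M[R]_k) : posdef A -> A \in unitmx.
Proof.
case=> _ Apos; rewrite -row_free_unit; apply: inj_row_free => v vA.
apply/eqP; apply: contraT => v0.
have: 0 < bilin A v^T v^T by apply: Apos; rewrite trmx_eq0.
by rewrite /bilin trmxK vA mul0mx mxtrace0 ltxx.
Qed.

Lemma posdef_inv (R : numFieldType) k (A : 'M[R]_k) : posdef A -> posdef (invmx A).
Proof.
move=> pA; have uA := posdef_unit pA; case: pA => Asym Apos.
split; first by rewrite trmx_inv Asym.
move=> x x0; have -> : x = A *m (invmx A *m x) by rewrite mulKVmx.
rewrite -bilinM Asym mulmxV // mul1mx; apply: Apos.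
by apply: contra x0 => /eqP ix0; rewrite -(mulKVmx uA x) ix0 mulmx0.
Qed.

Lemma posdef_CauchySchwarz (R : realFieldType) k (A : 'M[R]_k) x y :
  posdef A -> bilin A x y ^+ 2 <= bilin A x x * bilin A y y.
Proof.
move=> pA; have [->|y0] := eqVneq y 0.
  by rewrite /bilin !mulmx0 mxtrace0 expr0n mulr0.
have yy : 0 < bilin A y y by case: pA => _; apply.
have := posdef_ge0 (bilin A y y *: x + (- bilin A x y) *: y) pA.
rewrite bilinDl !bilinDr !bilinZl !bilinZr (bilin_sym y x (proj1 pA)) => h.
have {h} : 0 <= bilin A y y * (bilin A x x * bilin A y y - bilin A x y ^+ 2).
  by apply: le_trans h _; rewrite le_eqVlt; apply/orP; left; apply/eqP; ring.
by rewrite pmulr_rge0 // subr_ge0.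
Qed.

(** The norms defined by [A] and by its inverse are dual to each other: this is
Cauchy-Schwarz for [x] and [A^-1 v]. *)
Lemma posdef_dual_CauchySchwarz (R : realFieldType) k (A : 'M[R]_k) x v :
  posdef A -> \tr (x^T *m v) ^+ 2 <= bilin A x x * bilin (invmx A) v v.
Proof.
move=> pA; have uA := posdef_unit pA.
have := posdef_CauchySchwarz x (invmx A *m v) pA.
have -> : bilin A x (invmx A *m v) = \tr (x^T *m v).
  by rewrite /bilin -mulmxA mulKVmx.
by rewrite -bilinM trmx_inv (proj1 pA) mulVmx // mul1mx.
Qed.

(** Inversion reverses the Loewner order; a square root of the matrix is avoided by
testing the dual Cauchy-Schwarz inequality on [B^-1 x] and [x]. *)
Lemma posdef_inv_anti (R : realFieldType) k (A B : 'M[R]_k) x :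
  posdef A -> posdef B -> (forall y, bilin A y y <= bilin B y y) ->
  bilin (invmx B) x x <= bilin (invmx A) x x.
Proof.
move=> pA pB AB; have uB := posdef_unit pB.
have := posdef_dual_CauchySchwarz (invmx B *m x) x pA.
have -> : \tr ((invmx B *m x)^T *m x) = bilin (invmx B) x x.
  by rewrite trmx_mul trmx_inv (proj1 pB).
move=> h; have hx := AB (invmx B *m x).
have eB : bilin B (invmx B *m x) (invmx B *m x) = bilin (invmx B) x x.
  by rewrite -bilinM trmx_inv (proj1 pB) mulVmx // mul1mx.
rewrite eB in hx.
have b0 := posdef_ge0 x (posdef_inv pB); have a0 := posdef_ge0 x (posdef_inv pA).
have [/eqP e0|bpos] := eqVneq (bilin (invmx B) x x) 0; first by rewrite (eqP e0).
have {}bpos : 0 < bilin (invmx B) x x by rewrite lt_def bpos.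
rewrite -(ler_pM2l bpos) -expr2; apply: le_trans h _.
by rewrite ler_wpM2r.
Qed.

Lemma posdef_addouter (R : realFieldType) k (A : 'M[R]_k) (v : 'cV_k) :
  posdef A -> posdef (A + v *m v^T).
Proof.
case=> Asym Apos; split; first by rewrite linearD /= Asym trmx_mul trmxK.
by move=> x x0; rewrite bilinDm bilin_outer_sq ltr_pwDl ?sqr_ge0 ?Apos.
Qed.

(** The Sherman-Morrison formula. *)
Lemma inv_addouter (R : realFieldType) k (A : 'M[R]_k) (v : 'cV_k) : posdef A ->
  invmx (A + v *m v^T) =
  invmx A - (1 + bilin (invmx A) v v)^-1 *: (invmx A *m (v *m v^T) *m invmx A).
Proof.
move=> pA; have uA := posdef_unit pA; have uS := posdef_unit (posdef_addouter v pA).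
set B := invmx A; set h := bilin B v v.
have h0 : 0 <= h by apply: posdef_ge0; apply: posdef_inv.
rewrite -[RHS](mulKmx uS) -[LHS]mulmx1; congr (_ *m _).
set g := (1 + h)^-1; set P := v *m v^T *m B.
have hP : v *m v^T *m (B *m (v *m v^T) *m B) = h *: P.
  rewrite -!mulmxA (mulmxA v^T) (mulmxA (v^T *m B)) bilin_scalar.
  by rewrite mul_scalar_mx -scalemxAr !mulmxA.
have AP : A *m (B *m (v *m v^T) *m B) = P by rewrite -!mulmxA mulKVmx // !mulmxA.
have AB : A *m B = 1%:M by exact: mulmxV.
rewrite mulmxBr mulmxDl AB -/P -scalemxAr mulmxDl AP hP.
have -> : P + h *: P = (1 + h) *: P by rewrite scalerDl scale1r.
by rewrite scalerA mulVf ?scale1r ?addrK // gt_eqF // ltr_pwDl.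
Qed.

(** The matrix determinant lemma, from two triangular factorizations of the block
matrix [W]. *)
Lemma det_addrank1 (R : comUnitRingType) k (A : 'M[R]_k) (u : 'cV_k) (v : 'rV_k) :
  A \in unitmx -> \det (A + u *m v) = \det A * (1 + \tr (v *m invmx A *m u)).
Proof.
move=> uA; pose W := block_mx 1%:M v (- u) A.
have <- : \det W = \det (A + u *m v).
  have -> : W = block_mx 1%:M 0 (- u) 1%:M *m block_mx (1%:M : 'M[R]_1) v 0 (A + u *m v).
    rewrite /W mulmx_block !mul1mx !mulmx1 !mul0mx !addr0.
    by rewrite mulNmx addrC addrK.
  by rewrite det_mulmx det_lblock det_ublock !det1 !mul1r.
have : W *m block_mx 1%:M 0 (invmx A *m u) 1%:M =
       block_mx (1%:M + v *m invmx A *m u) v 0 A.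
  rewrite /W mulmx_block !mulmx1 !mulmx0 !add0r.
  by rewrite mulKVmx // addNr mulmxA.
move/(congr1 (fun X : 'M[R]_(1 + k) => \det X)); rewrite det_mulmx det_lblock det_ublock.
rewrite !det1 !mulr1 => ->; rewrite mulrC; congr (_ * _).
by rewrite det_mx11 mxE trace_mx11 mxE eqxx.
Qed.

(** * The lower barrier argument *)

(** [G] behaves like the expectation of [u u^T] over a probability measure carried
by [D]: the expectation of the quadratic form [u^T X u] is [tr (X G)], and it
exceeds any number that the form exceeds throughout [D].  Strictness is what
produces points of [D] where a form is at least its mean. *)
Definition second_moment (R : numDomainType) (T : Type) (D : set T) k
    (u : T -> 'cV[R]_k) (G : 'M[R]_k) : Prop :=
  G^T = G /\ forall X c, (forall y, D y -> c < bilin X (u y) (u y)) -> c < \tr (X *m G).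

Lemma second_moment_nonempty (R : numDomainType) (T : Type) (D : set T) k
    (u : T -> 'cV[R]_k) (G : 'M[R]_k) : second_moment D u G -> exists y, D y.
Proof.
case=> _ hG; apply/not_existsP => noD.
by have := hG 0 0 (fun y Dy => False_ind _ (noD y Dy)); rewrite mul0mx mxtrace0 ltxx.
Qed.

Lemma second_moment_ge (R : realDomainType) (T : Type) (D : set T) k
    (u : T -> 'cV[R]_k) (G X : 'M[R]_k) c : second_moment D u G ->
  (forall y, D y -> c <= bilin X (u y) (u y)) -> c <= \tr (X *m G).
Proof.
case=> _ hG hX; rewrite leNgt; apply/negP => neg.
by have := hG X _ (fun y Dy => lt_le_trans neg (hX y Dy)); rewrite ltxx.
Qed.

(** Put [C = S^-1], [Q = S - G / 2] and [B = Q^-1].  By the Sherman-Morrison formula,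
the potential of [Q + u u^T] is [tr (G B) - u^T B G B u / (1 + u^T B u)], so [u] has
to satisfy [u^T B G B u >= (b / 2) (1 + u^T B u)], where
[b / 2 = tr (G B) - tr (G C)] is the increase of the potential caused by the shift.
On average this reads [tr (G B G B) >= (b / 2) (1 + tr (G B))].  The resolvent
identity [B - C = B G C / 2 = C G B / 2] turns the left-hand side into [b + c / 2]
with [b = tr (B G C G)] and [c = tr (B G C G B G)], and [c >= b^2] by a
Cauchy-Schwarz inequality for the form [tr (X^T C Y G)]. *)
Lemma barrier_step (R : realFieldType) (T : Type) (D : set T) k
    (u : T -> 'cV[R]_k) (G S : 'M[R]_k) :
  second_moment D u G -> posdef S -> \tr (G *m invmx S) <= 1 ->
  exists y, [/\ D y, posdef (S - 2^-1 *: G + u y *m (u y)^T) &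
    \tr (G *m invmx (S - 2^-1 *: G + u y *m (u y)^T)) <= 1].
Proof.
move=> hG pS Phi_le1; have uS := posdef_unit pS; have [Gsym hG'] := hG.
set C := invmx S in Phi_le1 *; have pC : posdef C := posdef_inv pS.
set Phi := \tr (G *m C) in Phi_le1 *.
have G_ge0 x : 0 <= bilin G x x.
  rewrite bilinE mxtrace_mulC; apply: (second_moment_ge hG) => y Dy.
  by rewrite bilin_outer_sq sqr_ge0.
(* With tr (G C) <= 1, dual Cauchy-Schwarz averaged over u gives G <= S. *)
have G_leS x : bilin G x x <= bilin S x x.
  have : 0 <= \tr ((bilin S x x *: C - x *m x^T) *m G).
    apply: (second_moment_ge hG) => y Dy.
    rewrite bilinDm bilinNm bilinZm bilin_outer_sq subr_ge0.
    exact: posdef_dual_CauchySchwarz.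
  rewrite mulmxBl raddfB /= -scalemxAl mxtraceZ subr_ge0.
  rewrite mxtrace_mulC -bilinE mxtrace_mulC -/Phi => h; apply: le_trans h _.
  by rewrite ler_piMr // posdef_ge0.
set Q := S - 2^-1 *: G.
have Q_leS x : bilin Q x x <= bilin S x x.
  by rewrite bilinDm bilinNm bilinZm; have := G_ge0 x; lra.
have pQ : posdef Q.
  split=> [|x x0]; first by rewrite linearB linearZ /= Gsym (proj1 pS).
  rewrite bilinDm bilinNm bilinZm; have := G_leS x; have := proj2 pS x x0; lra.
set B := invmx Q; have uQ := posdef_unit pQ; have pB : posdef B := posdef_inv pQ.
have SQ : S - Q = 2^-1 *: G by rewrite /Q opprB addrC subrK.
have BC : B - C = 2^-1 *: (B *m G *m C).
  rewrite scalemxAl scalemxAr -SQ mulmxBr mulmxBl mulVmx // mul1mx.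
  by rewrite -mulmxA mulmxV // mulmx1.
have CB : B - C = 2^-1 *: (C *m G *m B).
  rewrite scalemxAl scalemxAr -SQ mulmxBr mulmxBl mulVmx // mul1mx.
  by rewrite -mulmxA mulmxV // mulmx1.
set b := \tr (B *m G *m C *m G); set c := \tr (B *m G *m C *m G *m B *m G).
have PhiB : \tr (B *m G) = Phi + b / 2.
  rewrite -(subrK C B) mulmxDl mxtraceD BC -scalemxAl mxtraceZ -/b.
  by rewrite (mxtrace_mulC C) -/Phi addrC mulrC.
have b_ge0 : 0 <= b.
  have : 0 <= \tr ((B - C) *m G).
    apply: (second_moment_ge hG) => y Dy; rewrite bilinDm bilinNm subr_ge0.
    exact: posdef_inv_anti.
  by rewrite BC -scalemxAl mxtraceZ -/b pmulr_rge0 // invr_gt0.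
have BGBG : \tr (B *m G *m B *m G) = b + c / 2.
  rewrite -[X in _ *m X *m _](subrK C B) CB mulmxDr mulmxDl mxtraceD -/b.
  by rewrite -scalemxAr -scalemxAl mxtraceZ !mulmxA -/c addrC mulrC.
have c_ge : b ^+ 2 <= c.
  (* The trace below expands to b^2 tr (C G) - 2 b^2 + c, and tr (C G) <= 1. *)
  pose Z := b%:M - G *m B.
  have : 0 <= \tr (Z^T *m C *m Z *m G).
    by apply: (second_moment_ge hG) => y Dy; rewrite bilinM posdef_ge0.
  have -> : Z^T = b%:M - B *m G.
    by rewrite raddfB /= tr_scalar_mx trmx_mul Gsym (proj1 pB).
  rewrite /Z !(mulmxBl, mulmxBr, mul_scalar_mx, mul_mx_scalar, raddfB, mxtraceZ) /=.
  rewrite -!scalemxAl !mxtraceZ !mulmxA -/b -/c.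
  have -> : \tr (C *m G *m B *m G) = b by rewrite -mulmxA mxtrace_mulC !mulmxA.
  rewrite (mxtrace_mulC C) -/Phi => h.
  nra.
suff [y [Dy hy]] : exists y, D y /\
    b / 2 * (1 + bilin B (u y) (u y)) <= bilin (B *m G *m B) (u y) (u y).
  exists y; split => //; first exact: posdef_addouter.
  rewrite inv_addouter // -/B mulmxBr raddfB /= -scalemxAr mxtraceZ.
  rewrite (mxtrace_mulC G B) PhiB.
  have -> : \tr (G *m (B *m (u y *m (u y)^T) *m B)) = bilin (B *m G *m B) (u y) (u y).
    by rewrite bilinE !mulmxA mxtrace_mulC !mulmxA.
  have h1 : 0 < 1 + bilin B (u y) (u y) by rewrite ltr_pwDl // posdef_ge0.
  have : b / 2 <= (1 + bilin B (u y) (u y))^-1 * bilin (B *m G *m B) (u y) (u y).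
    by rewrite [leRHS]mulrC ler_pdivlMr.
  lra.
apply/not_existsP => no.
have : - (b / 2) < \tr (((b / 2) *: B - B *m G *m B) *m G).
  apply: hG' => y Dy; rewrite bilinDm bilinNm bilinZm.
  have : ~ (b / 2 * (1 + bilin B (u y) (u y)) <= bilin (B *m G *m B) (u y) (u y)).
    by move=> h; apply: (no y).
  by move/negP; rewrite -ltNge; lra.
rewrite mulmxBl raddfB /= -scalemxAl mxtraceZ PhiB BGBG.
nra.
Qed.

Lemma barrier_iter (R : realFieldType) (T : Type) (D : set T) k
    (u : T -> 'cV[R]_k) (G S : 'M[R]_k) n :
  second_moment D u G -> posdef S -> \tr (G *m invmx S) <= 1 ->
  exists y : nat -> T, (forall j, D (y j)) /\
    posdef (S + \sum_(j < n) u (y j) *m (u (y j))^T - (n%:R / 2) *: G).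
Proof.
move=> hG pS le1.
suff [y [Dy py _]] : exists y : nat -> T, [/\ forall j, D (y j),
    posdef (S + \sum_(j < n) u (y j) *m (u (y j))^T - (n%:R / 2) *: G) &
    \tr (G *m invmx (S + \sum_(j < n) u (y j) *m (u (y j))^T - (n%:R / 2) *: G)) <= 1].
  by exists y.
elim: n => [|n [y [Dy py ley]]].
  have [z Dz] := second_moment_nonempty hG.
  by exists (fun=> z); rewrite big_ord0 mul0r scale0r addr0 subr0.
have [z [Dz pz lez]] := barrier_step hG py ley.
exists (fun j => if (j < n)%N then y j else z).
rewrite big_ord_recr /= ltnn.
under eq_bigr => i _ do rewrite ltn_ord.
set M' := S + _ - _; suff -> : M' = S + \sum_(j < n) u (y j) *m (u (y j))^T -
    (n%:R / 2) *: G - 2^-1 *: G + u z *m (u z)^T.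
  by split=> // j; case: ifP.
rewrite /M' -natr1 mulrDl mul1r scalerDl opprD !addrA.
by rewrite -!addrA; do 2 congr (_ + _); rewrite addrC -addrA.
Qed.

(** * Near-optimal designs *)

Definition gram (R : pzRingType) (T : Type) k (u : T -> 'cV[R]_k) m (x : nat -> T)
  : 'M[R]_k := \sum_(j < m) u (x j) *m (u (x j))^T.

Lemma bilin_sum (R : comPzRingType) k (I : finType) (A : I -> 'M[R]_k) x y :
  bilin (\sum_i A i) x y = \sum_i bilin (A i) x y.
Proof.
by elim/big_ind2: _ => [|A1 b1 A2 b2 <- <-|//]; rewrite ?bilinDm // bilinE mul0mx mxtrace0.
Qed.

Lemma bilin_gram (R : comPzRingType) (T : Type) k (u : T -> 'cV[R]_k) m (x : nat -> T) c :
  bilin (gram u m x) c c = \sum_(j < m) \tr ((u (x j))^T *m c) ^+ 2.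
Proof. by rewrite /gram bilin_sum; apply: eq_bigr => j _; rewrite bilin_outer_sq. Qed.

Lemma gram_sym (R : comPzRingType) (T : Type) k (u : T -> 'cV[R]_k) m (x : nat -> T) :
  (gram u m x)^T = gram u m x.
Proof.
by rewrite /gram linear_sum /=; apply: eq_bigr => j _; rewrite trmx_mul trmxK.
Qed.

Lemma gram_posdef (R : realFieldType) (T : Type) k (u : T -> 'cV[R]_k) m (x : nat -> T) :
  (forall c : 'cV[R]_k, (forall j : 'I_m, (u (x j))^T *m c = 0) -> c = 0) ->
  posdef (gram u m x).
Proof.
move=> inj; split=> [|c c0]; first exact: gram_sym.
rewrite lt_def bilin_gram sumr_ge0 ?andbT; last by move=> j _; exact: sqr_ge0.
apply: contra c0 => /eqP/psumr_eq0P s0; apply/eqP/inj => j.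
have /eqP := s0 (fun i _ => sqr_ge0 _) j isT.
by rewrite expf_eq0 trace_mx11 => /eqP e0; rewrite [LHS]mx11_scalar e0 raddf0.
Qed.

Lemma unit_gram_posdef (R : realFieldType) (T : Type) k (u : T -> 'cV[R]_k) m
    (x : nat -> T) :
  gram u m x \in unitmx -> posdef (gram u m x).
Proof.
move=> uM; apply: gram_posdef => c c0; rewrite -(mulKmx uM c) mulmx_suml big1 ?mulmx0 //.
by move=> j _; rewrite -mulmxA c0 mulmx0.
Qed.

(** The new point is added before the old one is removed, which lets the determinant
be updated by two rank one steps through positive definite matrices. *)
Lemma gram_exchange (R : comPzRingType) (T : Type) k (u : T -> 'cV[R]_k) m (x : nat -> T)
    (j : 'I_m) y :
  gram u m (fun i => if i == j :> nat then y else x i) =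
  gram u m x + u y *m (u y)^T + (- u (x j)) *m (u (x j))^T.
Proof.
rewrite /gram (bigD1 j) //= eqxx [in RHS](bigD1 j) //= mulNmx.
rewrite [RHS]addrAC [X in _ = X + _]addrAC subrr add0r [RHS]addrC; congr (_ + _).
by apply: eq_bigr => i; rewrite -val_eqE => /negbTE /= ->.
Qed.

(** The triangle inequality in the Leibniz expansion; this is what makes the supremum
of the determinants over all designs finite. *)
Lemma norm_det_le (R : realFieldType) k (A : 'M[R]_k) b :
  (forall i j, `|A i j| <= b) -> `|\det A| <= \sum_(s : {perm 'I_k}) b ^+ k.
Proof.
move=> hb; apply: le_trans (ler_norm_sum _ _ _) _; apply: ler_sum => s _.
rewrite normrM normrX normrN1 expr1n mul1r normr_prod.
rewrite -[k in b ^+ k]card_ord -prodr_const.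
by apply: ler_prod => i _; rewrite normr_ge0 /=.
Qed.

Lemma norm_gram_le (R : realFieldType) (T : Type) (D : set T) k (u : T -> 'cV[R]_k) b m
    (x : nat -> T) i j : (forall y l, D y -> `|u y l 0| <= b) -> (forall l, D (x l)) ->
  `|gram u m x i j| <= m%:R * b ^+ 2.
Proof.
move=> hb Dx; rewrite /gram summxE; apply: le_trans (ler_norm_sum _ _ _) _.
rewrite -[m in m%:R]card_ord mulr_natl -sumr_const; apply: ler_sum => l _.
rewrite mxE big_ord1 mxE normrM expr2; apply: ler_pM => //; exact: hb.
Qed.

(** The leverages add up to the trace of [M^-1 M], that is to the dimension. *)
Lemma gram_leverage (R : realFieldType) (T : Type) k (u : T -> 'cV[R]_k) m (x : nat -> T) :
  posdef (gram u m x) ->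
  \sum_(j < m) bilin (invmx (gram u m x)) (u (x j)) (u (x j)) = k%:R.
Proof.
move=> pM; rewrite -(mxtrace1 R k) -(mulVmx (posdef_unit pM)) {3}/gram mulmx_sumr raddf_sum.
by apply: eq_bigr => j _; rewrite bilinE.
Qed.

(** Choose points whose Gram determinant is more than 3/4 of the supremum, both in
absolute value.  Some leverage
is at most 1/3, since their mean is [k / (3 k)].  Adding [y], of leverage [h],
multiplies the determinant by [1 + h]; removing the point of small leverage then
multiplies it by at least 2/3.  Hence [(1 + h) * 2/3 <= 4/3].  A mere near-maximum
is enough, so boundedness of [u] replaces compactness.  The points [z], at which
[u] runs through the standard basis, guarantee a nonzero determinant. *)
Lemma exists_design (R : realType) (T : Type) (D : set T) k (u : T -> 'cV[R]_k) b
    (z : 'I_k -> T) z0 :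
  (forall y l, D y -> `|u y l 0| <= b) -> D z0 -> (forall i, D (z i)) ->
  (forall i, u (z i) = delta_mx i 0) ->
  exists x : nat -> T, [/\ forall j, D (x j), posdef (gram u (3 * k) x) &
    forall y, D y -> bilin (invmx (gram u (3 * k) x)) (u y) (u y) <= 1].
Proof.
case: k u z => [|k] u z hb Dz0 Dz uz.
  exists (fun=> z0); split=> // [|y Dy].
    by split=> [|x]; rewrite ?[x]flatmx0 ?eqxx //; apply/matrixP => -[].
  by rewrite /bilin (flatmx0 (u y)) mulmx0 mxtrace0.
set m := (3 * k.+1)%N.
pose S : set R := [set `|\det (gram u m x)| | x in [set x | forall j, D (x j)]]%classic.
pose w j := if insub j is Some i then z i else z0.
have Dw j : D (w j) by rewrite /w; case: insub.
have dw : 0 < `|\det (gram u m w)|.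
  rewrite normr_gt0 -unitfE -unitmxE; apply: posdef_unit; apply: gram_posdef => c c0.
  apply/colP => i; rewrite mxE.
  have im : (i < m)%N by rewrite (leq_trans (ltn_ord i)) // leq_pmull.
  have := c0 (Ordinal im); rewrite /w /= valK uz trmx_delta -rowE.
  by move/matrixP/(_ 0 0); rewrite !mxE.
have supS : has_sup S.
  split; first by exists `|\det (gram u m w)|, w.
  exists (\sum_(s : {perm 'I_k.+1}) (m%:R * b ^+ 2) ^+ k.+1) => _ [x Dx <-].
  apply: norm_det_le => i j.
  exact: norm_gram_le hb Dx.
have sup1 : 0 < sup S by apply: lt_le_trans dw _; apply: ub_le_sup; [case: supS|exists w].
have [_ [x Dx <-] hx] : exists2 e, S e & sup S - sup S / 4 < e.
  by apply: sup_adherent => //; rewrite divr_gt0.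
have pM : posdef (gram u m x).
  by apply: unit_gram_posdef; rewrite unitmxE unitfE -normr_gt0; lra.
exists x; split=> // y Dy.
set M := gram u m x in pM hx *.
have [j hj] : exists j : 'I_m, bilin (invmx M) (u (x j)) (u (x j)) <= 3^-1.
  apply/existsP; apply: contraT => /existsPn no.
  have := @gram_leverage _ _ _ u m x pM; rewrite -/M => e.
  suff : k.+1%:R < k.+1%:R :> R by rewrite ltxx.
  rewrite -{2}e; have -> : k.+1%:R = \sum_(j < m) 3^-1 :> R.
    rewrite sumr_const card_ord -[RHS]mulr_natl /m natrM mulrAC.
    by rewrite mulfV ?mul1r // pnatr_eq0.
  apply: ltr_sum => [|j _]; last by rewrite ltNge no.
  by apply/hasP; exists ord0; rewrite ?mem_index_enum.
pose x' i := if i == j :> nat then y else x i.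
have dx' : `|\det (gram u m x')| <= sup S.
  by apply: ub_le_sup; [case: supS|exists x' => // i; rewrite /x'; case: ifP].
have pM' := posdef_addouter (u y) pM; set M' := M + _ in pM'.
have hM' : bilin (invmx M') (u (x j)) (u (x j)) <= bilin (invmx M) (u (x j)) (u (x j)).
  by apply: posdef_inv_anti => // c; rewrite bilinDm bilin_outer_sq lerDl sqr_ge0.
move: dx'; rewrite gram_exchange det_addrank1 -/M -/M' ?posdef_unit //.
rewrite mulmxN raddfN /= -/(bilin _ _ _).
rewrite det_addrank1 ?posdef_unit // -/(bilin _ _ _).
set h := bilin _ (u y) _; have h0 : 0 <= h by apply: posdef_ge0; exact: posdef_inv.
have h1 : 0 < 1 + h by rewrite ltr_pwDl.
rewrite -mulrA normrM (ger0_norm (_ : 0 <= (1 + h) * _)); last first.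
  by rewrite mulr_ge0 ?ltW //; lra.
rewrite mulrA => le.
have d0 : 0 < `|\det M| by lra.
have : `|\det M| * (1 + h) * (2 / 3) <= sup S.
  apply: le_trans le; rewrite ler_pM2l; last by rewrite mulr_gt0.
  by move: hM' hj; lra.
nra.
Qed.

(** The design makes the potential of [M] at most 1, since [tr (G M^-1)] is the mean
of the leverages [u y^T M^-1 u y]; this starts the barrier argument. *)
Lemma exists_discretization (R : realType) (T : Type) (D : set T) k (u : T -> 'cV[R]_k) b
    (z : 'I_k -> T) G n :
  second_moment D u G -> (forall y l, D y -> `|u y l 0| <= b) -> (forall i, D (z i)) ->
  (forall i, u (z i) = delta_mx i 0) ->
  exists x : nat -> T, (forall j, D (x j)) /\ forall c,
    (forall y, D y -> \tr ((u y)^T *m c) ^+ 2 <=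
      \sum_(j < 3 * k + n) \tr ((u (x j))^T *m c) ^+ 2) /\
    n%:R / 2 * bilin G c c <= \sum_(j < 3 * k + n) \tr ((u (x j))^T *m c) ^+ 2.
Proof.
move=> hG hb Dz uz; have [z0 Dz0] := second_moment_nonempty hG.
have [x [Dx pM hM]] := exists_design hb Dz0 Dz uz.
set m := (3 * k)%N in x Dx pM hM *.
have trM : \tr (G *m invmx (gram u m x)) <= 1.
  have : - 1 <= \tr (- invmx (gram u m x) *m G).
    by apply: (second_moment_ge hG) => y Dy; rewrite bilinNm lerN2; exact: hM.
  by rewrite mulNmx raddfN /= lerN2 mxtrace_mulC.
have [y [Dy py]] := barrier_iter n hG pM trM.
exists (fun j => if (j < m)%N then x j else y (j - m)%N); split.
  by move=> j; case: ifP.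
move=> c; rewrite big_split_ord /=.
under eq_bigr => i _ do rewrite ltn_ord.
under [X in _ + X]eq_bigr => i _ do rewrite ltnNge leq_addr /= addKn.
rewrite -(bilin_gram u m x) -(bilin_gram u n y).
split=> [v Dv|]; last first.
  by have := posdef_ge0 c py; rewrite -/(gram u n y) bilinDm bilinNm bilinZm bilinDm; lra.
rewrite dot_sym -[leLHS]addr0; apply: lerD; last first.
  by rewrite bilin_gram sumr_ge0 // => j _; exact: sqr_ge0.
apply: le_trans (posdef_dual_CauchySchwarz c (u v) pM) _.
by rewrite ler_piMr ?hM // posdef_ge0.
Qed.

(** * Coordinates for a possibly dependent family *)

(** A maximal linearly independent family of evaluations [v (z i)] spans all of them.
The coordinates [v y *m W] in this basis are still linear in [v y], hence inherit
boundedness and measurability, and become standard basis vectors at the [z i]. *)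
Lemma exists_coordinates (F : fieldType) (T : Type) (D : set T) n (v : T -> 'rV[F]_n) z0 :
  D z0 -> exists k (z : 'I_k -> T) (W : 'M[F]_(n, k)) (V : 'M[F]_(k, n)),
  [/\ (k <= n)%N, forall i, D (z i), forall i, v (z i) *m W = delta_mx 0 i &
      forall y, D y -> v y *m W *m V = v y].
Proof.
move=> Dz0.
pose P k := `[< exists z : 'I_k -> T, (forall i, D (z i)) /\
  row_free (\matrix_(i < k) v (z i)) >].
have P0 : exists k, P k.
  exists 0%N; apply/asboolP; exists (fun=> z0); split=> //.
  by rewrite /row_free eqn_leq rank_leq_row.
have Pn k : P k -> (k <= n)%N.
  by move=> /asboolP[z [_ /eqP <-]]; exact: rank_leq_col.
case: (ex_maxnP P0 Pn) => k Pk kmax.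
have kn := Pn _ Pk; case/asboolP: Pk => z [Dz free].
set V := \matrix_(i < k) v (z i) in free.
exists k, z, (pinvmx V), V; split=> // [i|y Dy].
  have -> : v (z i) = delta_mx 0 i *m V by rewrite -rowE rowK.
  by rewrite -mulmxA mulmxVp ?mulmx1.
rewrite mulmxKpV //; apply: contraT => notin.
suff /kmax : P (k + 1)%N by rewrite addn1 ltnn.
apply/asboolP; exists (fun i => match fintype.split i with inl j => z j | inr _ => y end).
split; first by move=> i; case: fintype.split.
rewrite (_ : \matrix_i _ = col_mx V (v y)); last first.
  by apply/matrixP => i j; rewrite !mxE; case: fintype.split => l; rewrite ?mxE ?[l]ord1.
apply: inj_row_free => a; rewrite -[a]hsubmxK mul_row_col.
set a1 := lsubmx a; set a2 := rsubmx a => a0.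
have a20 : a2 = 0.
  apply/eqP; apply: contraR notin => a2n.
  have c0 : a2 0 0 != 0.
    by apply: contra a2n => /eqP e; rewrite [a2]mx11_scalar e raddf0.
  have e : a2 0 0 *: v y = - (a1 *m V).
    by apply/eqP; rewrite -addr_eq0 addrC -mul_scalar_mx -mx11_scalar; apply/eqP.
  rewrite (_ : v y = (- (a2 0 0)^-1 *: a1) *m V).
    exact: submxMl.
  by rewrite -scalemxAl scaleNr -scalerN -e scalerA mulVf // scale1r.
move: a0; rewrite a20 mul0mx addr0 => /eqP; rewrite mulmx_free_eq0 // => /eqP ->.
by rewrite row_mx0.
Qed.

(** * Second moments of a probability measure *)

(** A probability mean exceeds every strict lower bound: otherwise [f - c] would be
positive with integral zero, hence zero almost everywhere. *)
Lemma integral_gt (d : measure_display) (T : measurableType d) (R : realType)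
    (mu : {measure set T -> \bar R}) (D : set T) (f : T -> R) c :
  measurable D -> mu D = 1%E -> mu.-integrable D (EFin \o f) ->
  (forall y, D y -> c < f y) -> (c%:E < \int[mu]_(y in D) (f y)%:E)%E.
Proof.
move=> mD D1 fi cf.
have ci : mu.-integrable D (EFin \o (cst c : T -> R)).
  apply: (measurable_bounded_integrable mD) => //; first by rewrite D1 ltry.
  by exists `|c|; split=> // M cM y _ /=; exact: ltW.
have -> : (c%:E = \int[mu]_(y in D) (cst c y)%:E)%E.
  by rewrite /= integral_cst // D1 mule1.
rewrite -sube_gt0 -integralB_EFin //.
rewrite lt_def integral_ge0 ?andbT; last first.
  by move=> y Dy; rewrite lee_fin subr_ge0 ltW // cf.
apply/negP => /eqP int0.
have fci : mu.-integrable D (EFin \o (f \- cst c)).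
  by apply: eq_integrable (integrableB mD fi ci).
have mfc := measurable_int mu fci.
have /(ae_eq_integral_abs mu mD mfc) : (\int[mu]_(y in D) `|(f y - c)%R%:E| = 0)%E.
  rewrite -[RHS]int0; apply: eq_integral => y; rewrite inE => Dy /=.
  by rewrite ger0_norm // subr_ge0 ltW // cf.
case=> A [mA A0 sub].
have : mu D = 0%E.
  apply: (subset_measure0 mD mA _ A0) => y Dy; apply: sub => /= /(_ Dy) [].
  by apply/eqP; rewrite subr_eq0 gt_eqF // cf.
by rewrite D1 => /eqP; rewrite onee_eq0.
Qed.

Lemma second_moment_integral (d : measure_display) (T : measurableType d) (R : realType)
    (mu : {measure set T -> \bar R}) (D : set T) k (u : T -> 'cV[R]_k) b :
  measurable D -> mu D = 1%E ->
  (forall y l, D y -> `|u y l 0| <= b) ->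
  (forall l, measurable_fun D (fun y => u y l 0)) ->
  exists G, second_moment D u G /\
    forall X, (\int[mu]_(y in D) (bilin X (u y) (u y))%:E = (\tr (X *m G))%:E)%E.
Proof.
move=> mD D1 hb mu_.
have ui i j : mu.-integrable D (EFin \o (fun y => u y i 0 * u y j 0)).
  apply: (measurable_bounded_integrable mD); first by rewrite D1 ltry.
    exact: measurable_funM.
  exists (b * b); split=> // [|M bM y Dy /=].
    by apply: ger0_real; rewrite -expr2 sqr_ge0.
  rewrite normrM; apply: le_trans (ltW bM).
  by apply: ler_pM => //; exact: hb.
have Xi (X : 'M[R]_k) i j : mu.-integrable D
    (fun y => (X i j)%:E * (EFin \o (fun y => u y j 0 * u y i 0)%R) y)%E.
  exact: integrableZl.
have bfsum (X : 'M[R]_k) y :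
    (bilin X (u y) (u y))%:E = (\sum_i \sum_j (X i j)%:E * (u y j 0 * u y i 0)%:E)%E.
  rewrite bilinE /mxtrace -sumEFin; apply: eq_bigr => i _.
  rewrite mxE -sumEFin; apply: eq_bigr => j _.
  by rewrite mxE big_ord1 mxE EFinM.
pose G := \matrix_(i, j) fine (\int[mu]_(y in D) (u y i 0 * u y j 0)%:E).
have intE X : (\int[mu]_(y in D) (bilin X (u y) (u y))%:E = (\tr (X *m G))%:E)%E.
  under eq_integral do rewrite bfsum.
  rewrite integral_sum //; last by move=> i; exact: integrable_sum.
  rewrite /mxtrace -sumEFin; apply: eq_bigr => i _.
  rewrite integral_sum // mxE -sumEFin; apply: eq_bigr => j _.
  rewrite (integralZl mD (ui _ _)) /G mxE EFinM fineK //.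
  exact: integrable_fin_num (ui _ _).
exists G; split=> //; split.
  apply/matrixP => i j; rewrite !mxE; congr fine.
  by apply: eq_integral => y _; rewrite mulrC.
move=> X c hc; rewrite -lte_fin -intE; apply: integral_gt => //.
have : mu.-integrable D
    (fun y => \sum_i \sum_j (X i j)%:E * (u y j 0 * u y i 0)%:E)%E.
  by apply: integrable_sum => // i _; apply: integrable_sum => // j _; exact: Xi.
apply: eq_integrable => //.
by move=> y _; rewrite /= -bfsum.
Qed.

(** The family [g] may be linearly dependent, which is needed for the real and
imaginary parts of a complex basis. *)
Theorem real_discretization (d : measure_display) (T : measurableType d) (R : realType)
    (mu : {measure set T -> \bar R}) (D : set T) n (g : 'I_n -> T -> R) b N :
  measurable D -> mu D = 1%E ->
  (forall i y, D y -> `|g i y| <= b) -> (forall i, measurable_fun D (g i)) ->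
  exists m (x : nat -> T), [/\ (N <= m)%N, (m <= 3 * n + N)%N, forall j, D (x j) &
    forall c : 'I_n -> R, let f y := \sum_i c i * g i y in
      (forall y, D y -> f y ^+ 2 <= \sum_(j < m) f (x j) ^+ 2) /\
      ((N%:R / 2)%:E * \int[mu]_(y in D) (f y ^+ 2)%:E <=
       (\sum_(j < m) f (x j) ^+ 2)%:E)%E].
Proof.
move=> mD D1 hb mg.
have [z0 Dz0] : exists z0, D z0.
  apply/not_existsP => noD; have D0 : D = set0 by apply/seteqP; split=> // y /noD.
  by move/eqP: D1; rewrite D0 measure0 eq_sym onee_eq0.
pose v y : 'rV[R]_n := \row_i g i y.
have [k [z [W [V [kn Dz zW WV]]]]] := exists_coordinates v Dz0.
pose u y : 'cV[R]_k := (v y *m W)^T.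
have uE y l : u y l 0 = \sum_i g i y * W i l.
  by rewrite !mxE; apply: eq_bigr => i _; rewrite mxE.
pose b' := \sum_i \sum_l b * `|W i l|.
have hu y l : D y -> `|u y l 0| <= b'.
  move=> Dy; rewrite uE; apply: le_trans (ler_norm_sum _ _ _) _; apply: ler_sum => i _.
  have b0 : 0 <= b by apply: le_trans (hb i y Dy).
  rewrite (bigD1 l) //= normrM; apply: le_trans (_ : b * `|W i l| <= _).
    by apply: ler_wpM2r => //; exact: hb.
  by rewrite lerDl sumr_ge0 // => j _; rewrite mulr_ge0.
have mu_ l : measurable_fun D (fun y => u y l 0).
  under eq_fun do rewrite uE.
  apply: measurable_sum => i; apply: measurable_funM => //.
have [G [hG intG]] := second_moment_integral mD D1 hu mu_.
have uz i : u (z i) = delta_mx i 0 by rewrite /u zW trmx_delta.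
have [x [Dx hx]] := exists_discretization N hG hu Dz uz.
exists (3 * k + N)%N, x; split=> //; first exact: leq_addl.
  by rewrite leq_add2r leq_mul2l kn orbT.
move=> c f; pose C := V *m \col_i c i.
have fE y : D y -> f y = \tr ((u y)^T *m C).
  move=> Dy; rewrite /u trmxK /C mulmxA WV // trace_mx11 mxE.
  by apply: eq_bigr => i _; rewrite !mxE mulrC.
have -> : \sum_(j < 3 * k + N) f (x j) ^+ 2 =
          \sum_(j < 3 * k + N) \tr ((u (x j))^T *m C) ^+ 2.
  by apply: eq_bigr => j _; rewrite fE.
have [h1 h2] := hx C; split=> [y Dy|]; first by rewrite fE //; exact: h1.
suff -> : (\int[mu]_(y in D) (f y ^+ 2)%:E = (bilin G C C)%:E)%E by rewrite -EFinM lee_fin.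
rewrite bilinE mxtrace_mulC -intG; apply: eq_integral => y; rewrite inE => Dy.
by rewrite bilin_outer_sq fE // dot_sym.
Qed.

(** * Modulars of functions of type (aInc) *)

(** The integral of a nonnegative function is a supremum over the simple functions
below it, so its monotonicity does not depend on measurability; this applies to
[Phi] composed with a measurable function. *)
Lemma ge0_le_integral_nonmeasurable (d : measure_display) (T : measurableType d)
    (R : realType) (mu : {measure set T -> \bar R}) (D : set T) (f g : T -> \bar R) :
  (forall y, D y -> 0 <= f y)%E -> (forall y, D y -> f y <= g y)%E ->
  (\int[mu]_(y in D) f y <= \int[mu]_(y in D) g y)%E.
Proof.
move=> f0 fg; rewrite !ge0_integralE //; last first.
  by move=> y Dy; apply: le_trans (f0 y Dy) (fg y Dy).
apply: le_ereal_sup => _ [h hf <-]; exists h => // y.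
apply: le_trans (hf y) _; rewrite /patch; case: ifP => // /set_mem Dy; exact: fg.
Qed.

Lemma aInc_mono (R : realType) (Phi : R -> R) (p a s t : R) :
  Phi_function Phi -> aInc_with Phi p a -> 0 < s -> s <= t ->
  Phi s * s `^ (- p) <= a * (Phi t * t `^ (- p)).
Proof.
move=> hP [a1 ha] s0; rewrite le_eqVlt => /predU1P[<-|/ha]; last exact.
by rewrite ler_peMl // mulr_ge0 ?powR_ge0 // (Phi_ge0 hP) // ltW.
Qed.

(** Compare [Phi] at [h / L] and at [t] by (aInc)_p, then use [h / t <= 1] to lower the
exponent [p] to 2. *)
Lemma Phi_scaled_le (R : realType) (Phi : R -> R) (p a L t h : R) :
  2 <= p -> Phi_function Phi -> aInc_with Phi p a -> 1 <= L -> 0 < t ->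
  0 <= h -> h <= t -> Phi (h / L) <= a * Phi t / L `^ p * (h / t) ^+ 2.
Proof.
move=> p2 hP ha L1 t0 h0 ht.
have L0 : 0 < L by apply: lt_le_trans L1.
have a0 : 0 <= a by case: ha => a1 _; apply: le_trans a1.
have Pt : 0 <= Phi t by rewrite (Phi_ge0 hP) // ltW.
have [->|hn0] := eqVneq h 0.
  by rewrite !mul0r (Phi_at0 hP) expr0n mulr0.
have {h0}hpos : 0 < h by rewrite lt_def hn0.
set s := h / L; have s0 : 0 < s by rewrite divr_gt0.
have st : s <= t by apply: le_trans ht; rewrite ler_pdivrMr // ler_peMr // ltW.
have := aInc_mono hP ha s0 st.
rewrite !powRN => /(ler_wpM2r (powR_ge0 s p)).
rewrite mulfVK ?gt_eqF ?powR_gt0 // => /le_trans; apply.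
have -> : s = (h / t) * (t / L) by rewrite /s mulrA divfK ?gt_eqF.
have ht0 : 0 <= h / t by rewrite divr_ge0 // ltW.
have tL0 : 0 <= t / L by rewrite divr_ge0 // ltW.
have iL0 : 0 <= L^-1 by rewrite invr_ge0 ltW.
rewrite (powRM p ht0 tL0) (powRM p (ltW t0) iL0).
have -> : L^-1 `^ p = (L `^ p)^-1.
  by rewrite -powRN -(powR_inv1 (ltW L0)) -powRrM mulN1r.
rewrite [leLHS](_ : _ = a * Phi t / L `^ p * (h / t) `^ p); last first.
  by field; rewrite !gt_eqF ?powR_gt0.
apply: ler_wpM2l; first by rewrite !mulr_ge0 // invr_ge0 powR_ge0.
rewrite -powR_mulrn //; apply: ger_powR => //.
by rewrite divr_gt0 //= ler_pdivrMr // mul1r.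
Qed.

Lemma Phi_modular_le1 (R : realType) (d : measure_display) (T : measurableType d)
    (mu : {measure set T -> \bar R}) (D : set T) (Phi : R -> R) (p a L t : R) (h : T -> R) :
  2 <= p -> Phi_function Phi -> aInc_with Phi p a -> 1 <= L -> 0 < t ->
  a * Phi t / t ^+ 2 <= L `^ p ->
  measurable D -> measurable_fun D h ->
  (forall y, D y -> 0 <= h y <= t) -> (\int[mu]_(y in D) (h y ^+ 2)%:E <= 1)%E ->
  (\int[mu]_(y in D) (Phi (h y / L))%:E <= 1)%E.
Proof.
move=> p2 hP ha L1 t0 hL mD mh ht h2.
have L0 : 0 < L by apply: lt_le_trans L1.
have Lp : 0 < L `^ p by apply: powR_gt0.
pose K := a * Phi t / L `^ p / t ^+ 2.
have K0 : 0 <= K.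
  rewrite /K !mulr_ge0 ?invr_ge0 ?powR_ge0 ?(Phi_ge0 hP) ?(ltW t0) ?exprn_ge0 ?ltW //.
  by case: ha => a1 _; apply: lt_le_trans a1.
have K1 : K <= 1.
  by rewrite /K mulrAC ler_pdivrMr // mul1r.
apply: (@le_trans _ _ (\int[mu]_(y in D) (K%:E * (h y ^+ 2)%:E))%E).
  apply: ge0_le_integral_nonmeasurable => y Dy; have /andP[h0 hy] := ht _ Dy.
    by rewrite lee_fin (Phi_ge0 hP) // divr_ge0 // ltW.
  rewrite lee_fin; apply: le_trans (Phi_scaled_le p2 hP ha L1 t0 h0 hy) _.
  by rewrite /K expr_div_n mulrA mulrAC.
rewrite ge0_integralZl_EFin //; last 2 first.
- by move=> y Dy; rewrite lee_fin sqr_ge0.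
- by apply/measurable_EFinP; exact: measurable_funX.
by rewrite -[leRHS]mule1; apply: lee_pmul => //; rewrite ?lee_fin // integral_ge0 // => y _;
   rewrite lee_fin sqr_ge0.
Qed.

(** * Real and complex continuous functions on a compact set *)

Lemma compact_measurable_borelRd (R : realType) (d : nat) (Omega : set 'rV[R]_d) :
  compact Omega -> measurable (Omega : set (borelRd R d)).
Proof.
move=> /compact_closed cO; rewrite -[X in measurable X]setCK; apply: measurableC.
by apply: sub_sigma_algebra; rewrite /= openC; apply: cO; exact: norm_hausdorff.
Qed.

Lemma within_continuous_measurable (R : realType) (d : nat) (Omega : set 'rV[R]_d)
    (g : 'rV[R]_d -> R) :
  compact Omega -> {within Omega, continuous g} ->
  measurable_fun (Omega : set (borelRd R d)) (g : borelRd R d -> R).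
Proof.
move=> cO /continuousP cg; apply: (measurability _ (RGenOpens.measurableE R)).
move=> _ [_ [a [b ->] <-]].
have /open_subspaceP[V oV VO] : open (g @^-1` `]a, b[ : set (subspace Omega)).
  exact/cg/interval_open.
rewrite setIC -VO; apply: measurableI; last exact: compact_measurable_borelRd.
exact: sub_sigma_algebra.
Qed.

Lemma within_continuous_bounded (R : realType) (d : nat) (Omega : set 'rV[R]_d)
    (g : 'rV[R]_d -> R) :
  compact Omega -> {within Omega, continuous g} ->
  exists b, forall y, Omega y -> `|g y| <= b.
Proof.
move=> cO cg; have /compact_bounded[M [_ hM]] := continuous_compact cg cO.
by exists (M + 1) => y Oy; apply: hM; [rewrite ltrDl|exists y].
Qed.

(** The source carries the topology given by the complex-valued norm. *)
Lemma continuous_Re (R : realType) :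
  continuous (@complex.Re R : scalars R ComplexScalars -> R).
Proof.
move=> z; apply/(@cvgrPdist_lt _ _ _ _ (nbhs_filter z)) => e e0.
apply/nbhs_ballP; exists e%:C%C => [|w]; first by rewrite /= ltcR.
rewrite -ball_normE /= => zw.
by rewrite -ltcR -raddfB; apply: le_lt_trans (normc_ge_Re _) _.
Qed.

Lemma continuous_Im (R : realType) :
  continuous (@complex.Im R : scalars R ComplexScalars -> R).
Proof.
move=> z; apply/(@cvgrPdist_lt _ _ _ _ (nbhs_filter z)) => e e0.
apply/nbhs_ballP; exists e%:C%C => [|w]; first by rewrite /= ltcR.
rewrite -ball_normE /= => zw.
rewrite -ltcR -raddfB; apply: le_lt_trans zw.
rewrite normc_def lecR -[leLHS]sqrtr_sqr; apply: ler_wsqrtr.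
by rewrite lerDr sqr_ge0.
Qed.

Lemma exists_common_bound (R : realType) (T : Type) (D : set T) n (g : 'I_n -> T -> R) :
  (forall i, exists b, forall y, D y -> `|g i y| <= b) ->
  exists b, forall i y, D y -> `|g i y| <= b.
Proof.
move=> /fin_all_exists[b hb]; exists (\sum_i `|b i|) => i y Dy.
apply: le_trans (hb i y Dy) _; apply: le_trans (ler_norm _) _.
by rewrite (bigD1 i) //= lerDl sumr_ge0.
Qed.

Lemma continuous_discretization (R : realType) (d : nat) (Omega : set 'rV[R]_d)
    (mu : {measure set (borelRd R d) -> \bar R}) n (g : 'I_n -> 'rV[R]_d -> R) N :
  compact Omega -> mu Omega = 1%E -> (forall i, {within Omega, continuous (g i)}) ->
  exists m (x : 'I_m -> 'rV[R]_d), [/\ (N <= m)%N, (m <= 3 * n + N)%N,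
    forall j, Omega (x j) &
    forall c : 'I_n -> R, let f y := \sum_i c i * g i y in
      (forall y, Omega y -> f y ^+ 2 <= \sum_(j < m) f (x j) ^+ 2) /\
      ((N%:R / 2)%:E * \int[mu]_(y in Omega) (f y ^+ 2)%:E <=
       (\sum_(j < m) f (x j) ^+ 2)%:E)%E].
Proof.
move=> cO mu1 cg.
have [b hb] := exists_common_bound (fun i => within_continuous_bounded cO (cg i)).
have mg i := within_continuous_measurable cO (cg i).
have [m [x [Nm mN Ox hx]]] :=
  real_discretization N (compact_measurable_borelRd cO) mu1 hb mg.
by exists m, (fun j => x j).
Qed.

Lemma basis_in_subspace (R : realType) (d : nat) (k : scalar_kind) (Omega : set 'rV[R]_d)
    N (X : set ('rV[R]_d -> scalars R k)) (e : 'I_N -> 'rV[R]_d -> scalars R k) :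
  (forall f, X f <-> exists c : 'I_N -> scalars R k,
        forall x, Omega x -> f x = \sum_(i < N) c i * e i x) ->
  forall i, X (e i).
Proof.
move=> he i; apply/he; exists (fun j => (j == i)%:R) => y _.
by rewrite (bigD1 i) //= eqxx mul1r big1 ?addr0 // => j /negbTE ->; rewrite mul0r.
Qed.

Lemma normc_sq (R : rcfType) (z : R[i]) :
  ComplexField.Normc.normc z ^+ 2 = complex.Re z ^+ 2 + complex.Im z ^+ 2.
Proof. by case: z => a b /=; rewrite sqr_sqrtr // addr_ge0 // sqr_ge0. Qed.

Lemma modulus_ge0 (R : realType) (k : scalar_kind) (z : scalars R k) : 0 <= modulus z.
Proof. by case: k z => z /=; [exact: normr_ge0|case: z => a b; exact: sqrtr_ge0]. Qed.

(** In the complex case the span of [Re e_i] and [Im e_i] contains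
[s Re f + t Im f] for all real [s] and [t].  The mean square of [f] is the sum of
those of [Re f] and [Im f].  For the supremum at [y], take [s = Re (f y)] and
[t = Im (f y)]: this combination equals [|f y|^2] at [y] and is bounded by
[|f y| |f|] elsewhere. *)
Lemma subspace_discretization (R : realType) (d : nat) (k : scalar_kind)
    (Omega : set 'rV[R]_d) (mu : {measure set (borelRd R d) -> \bar R})
    N (X : set ('rV[R]_d -> scalars R k)) :
  (0 < N)%N -> compact Omega -> mu Omega = 1%E -> subspace_C_dim Omega N X ->
  exists m (x : 'I_m -> 'rV[R]_d), [/\ (0 < m)%N, (m <= 7 * N)%N,
    forall j, Omega (x j) &
    forall f, X f ->
      [/\ measurable_fun (Omega : set (borelRd R d)) (fun y => modulus (f y)),
      forall y, Omega y -> modulus (f y) ^+ 2 <= \sum_(j < m) modulus (f (x j)) ^+ 2 &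
      ((N%:R / 2)%:E * \int[mu]_(y in Omega) (modulus (f y) ^+ 2)%:E <=
       (\sum_(j < m) modulus (f (x j)) ^+ 2)%:E)%E]].
Proof.
move=> N0 cO mu1; case: k X => X [cX [e [_ he]]].
- have Xe := basis_in_subspace he.
  have [m [x [Nm mN Ox hx]]] := continuous_discretization N cO mu1 (fun i => cX _ (Xe i)).
  exists m, x; split=> //; first exact: leq_trans Nm.
    by apply: leq_trans mN _; rewrite -mulSnr leq_mul2r orbT.
  move=> f Xf; have [c hc] := (he f).1 Xf; have [h1 h2] := hx c.
  have cf : {within Omega, continuous f} := cX f Xf.
  have fE y : Omega y -> modulus (f y) ^+ 2 = (\sum_i c i * e i y : R) ^+ 2.
    by move=> Oy; rewrite hc // real_normK // num_real.
  have sE : \sum_(j < m) modulus (f (x j)) ^+ 2 =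
            \sum_(j < m) (\sum_i c i * e i (x j) : R) ^+ 2.
    by apply: eq_bigr => j _; rewrite fE.
  rewrite sE; split=> [|y Oy|].
  + by apply: measurableT_comp => //; exact: within_continuous_measurable cO cf.
  + by rewrite fE //; exact: h1.
  + apply: le_trans h2; rewrite le_eqVlt; apply/orP; left; apply/eqP; congr (_ * _)%E.
    by apply: eq_integral => y; rewrite inE => Oy; rewrite fE.
- have Xe := basis_in_subspace he.
  pose g (i : 'I_(N + N)) y : R := match fintype.split i with
    | inl j => complex.Re (e j y) | inr j => complex.Im (e j y) end.
  have cRe f : X f -> {within Omega, continuous (fun y => complex.Re (f y))}.
    move=> Xf y; apply: continuous_comp; first exact: cX.
    exact: continuous_Re.
  have cIm f : X f -> {within Omega, continuous (fun y => complex.Im (f y))}.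
    move=> Xf y; apply: continuous_comp; first exact: cX.
    exact: continuous_Im.
  have cg i : {within Omega, continuous (g i)}.
    by rewrite /g; case: fintype.split => j; [exact: cRe|exact: cIm].
  have [m [x [Nm mN Ox hx]]] := continuous_discretization N cO mu1 cg.
  exists m, x; split=> //; first exact: leq_trans Nm.
    by apply: leq_trans mN _; rewrite mulnDr -mulnDl -mulSnr.
  move=> f Xf; have [c hc] := (he f).1 Xf.
  have span s t : exists c' : 'I_(N + N) -> R, forall y, Omega y ->
      s * complex.Re (f y) + t * complex.Im (f y) = \sum_i c' i * g i y.
    exists (fun i => match fintype.split i with
      | inl j => s * complex.Re (c j) + t * complex.Im (c j)
      | inr j => t * complex.Re (c j) - s * complex.Im (c j) end) => y Oy.
    rewrite hc // !raddf_sum !mulr_sumr -big_split /= big_split_ord /= -big_split /=.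
    apply: eq_bigr => j _; rewrite /g !(unsplitK (inl j)) !(unsplitK (inr j)).
    case: (c j) (e j y) => [a b] [u v] /=; ring.
  have fE y : modulus (f y) ^+ 2 = complex.Re (f y) ^+ 2 + complex.Im (f y) ^+ 2.
    exact: normc_sq.
  have mRe := within_continuous_measurable cO (cRe f Xf).
  have mIm := within_continuous_measurable cO (cIm f Xf).
  split=> [|y Oy|].
  + rewrite (_ : (fun y => modulus (f y)) =
      (fun y => Num.sqrt (complex.Re (f y) ^+ 2 + complex.Im (f y) ^+ 2))); last first.
      by apply/funext => y; rewrite -fE sqrtr_sqr ger0_norm // modulus_ge0.
    have msqrt : measurable_fun setT (@Num.sqrt R).
      apply: continuous_measurable_fun => z; exact: sqrt_continuous.

    apply: (measurableT_comp msqrt).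
    by apply: measurable_funD; exact: measurable_funX.
  + have [c' hc'] := span (complex.Re (f y)) (complex.Im (f y)).
    have [/(_ y Oy)] := hx c'; rewrite -hc' // -!expr2 -fE => h _.
    have [->|r0] := eqVneq (modulus (f y) ^+ 2) 0.
      by rewrite sumr_ge0 // => j _; exact: sqr_ge0.
    have rpos : 0 < modulus (f y) ^+ 2 by rewrite lt_def r0 sqr_ge0.
    rewrite -(ler_pM2l rpos) -expr2; apply: le_trans h _.
    rewrite mulr_sumr; apply: ler_sum => j _; rewrite -hc' // !fE.
    set s := complex.Re (f y); set t := complex.Im _.
    set u := complex.Re _; set v := complex.Im _.
    by have := sqr_ge0 (s * v - t * u); nra.
  + have [c1 hc1] := span 1 0; have [c2 hc2] := span 0 1.
    have [_ h1] := hx c1; have [_ h2] := hx c2.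
    under eq_integral do rewrite fE EFinD.
    rewrite ge0_integralD //; last 5 first.
    * exact: compact_measurable_borelRd.
    * by move=> y _; rewrite lee_fin sqr_ge0.
    * by apply/measurable_EFinP; exact: measurable_funX.
    * by move=> y _; rewrite lee_fin sqr_ge0.
    * by apply/measurable_EFinP; exact: measurable_funX.
    rewrite muleDr // ?ge0_adde_def // ?inE ?integral_ge0 //; last 2 first.
    * by move=> y _; rewrite lee_fin sqr_ge0.
    * by move=> y _; rewrite lee_fin sqr_ge0.
    under [X in (_ <= X%:E)%E]eq_bigr => j _ do rewrite fE.
    rewrite big_split /= EFinD; apply: leeD.
    * rewrite (eq_bigr (fun j => (\sum_i c1 i * g i (x j)) ^+ 2)); last first.
        by move=> j _; rewrite -hc1 // mul1r mul0r addr0.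
      apply: le_trans h1; rewrite le_eqVlt; apply/orP; left; apply/eqP; congr (_ * _)%E.
      by apply: eq_integral => y; rewrite inE => Oy; rewrite -hc1 // mul1r mul0r addr0.
    * rewrite (eq_bigr (fun j => (\sum_i c2 i * g i (x j)) ^+ 2)); last first.
        by move=> j _; rewrite -hc2 // mul1r mul0r add0r.
      apply: le_trans h2; rewrite le_eqVlt; apply/orP; left; apply/eqP; congr (_ * _)%E.
      by apply: eq_integral => y; rewrite inE => Oy; rewrite -hc2 // mul1r mul0r add0r.
Qed.

(** * The Luxemburg norm *)

Lemma luxemburg_norm_le (R : realType) (d : nat) (Omega : set 'rV[R]_d)
    (mu : {measure set (borelRd R d) -> \bar R}) (Phi : R -> R) (k : scalar_kind)
    (f : 'rV[R]_d -> scalars R k) l :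
  0 < l -> (\int[mu]_(x in Omega) (Phi (modulus (f x) / l))%:E <= 1)%E ->
  (luxemburg_norm Omega mu Phi f <= l%:E)%E.
Proof. by move=> l0 hl; apply: ereal_inf_lbound; exists l. Qed.

Lemma luxemburg_norm_eq0 (R : realType) (d : nat) (Omega : set 'rV[R]_d)
    (mu : {measure set (borelRd R d) -> \bar R}) (Phi : R -> R) (k : scalar_kind)
    (f : 'rV[R]_d -> scalars R k) :
  Phi 0 = 0 -> (forall y, Omega y -> modulus (f y) = 0) ->
  (luxemburg_norm Omega mu Phi f <= 0)%E.
Proof.
move=> P0 f0; apply/lee_addgt0Pr => e e0; rewrite add0e; apply: luxemburg_norm_le => //.
rewrite (eq_integral (cst 0%E)) ?integral0 // => y; rewrite inE => Oy.
by rewrite f0 // mul0r P0.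
Qed.

Lemma sample_norm2_sq (R : realType) (d : nat) (k : scalar_kind) (m : nat)
    (x : 'I_m -> 'rV[R]_d) (f : 'rV[R]_d -> scalars R k) : (0 < m)%N ->
  \sum_(j < m) modulus (f (x j)) ^+ 2 = m%:R * sample_norm2 x f ^+ 2.
Proof.
move=> m0; rewrite sqr_sqrtr; last first.
  by rewrite mulr_ge0 ?invr_ge0 // sumr_ge0 // => j _; exact: sqr_ge0.
by rewrite mulrA mulfV ?mul1r // pnatr_eq0 -lt0n.
Qed.

(** The factor 4 normalizes [f]: as [m <= 7 N], the function [h = |f| / (4 A)]
satisfies [h^2 <= 7 N / 16] and [int h^2 <= (2 / N) (7 N / 16)]. *)
Lemma sampling_bound_scale (R : realType) (Phi : R -> R) (p a L c2 : R) (N : nat) :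
  2 <= p -> Phi_function Phi -> aInc_with Phi p a -> (0 < N)%N ->
  1 <= L -> a * (Phi (Num.sqrt N%:R) / N%:R) <= L `^ p ->
  4 * L <= c2 * (Phi (Num.sqrt N%:R) / N%:R) `^ p^-1 ->
  sampling_bound Phi p 7 c2 N.
Proof.
move=> p2 hP ha N0 L1 hL hc k d Omega mu X cO mu1 hX.
have [m [x [m0 m7 Ox hx]]] := subspace_discretization N0 cO mu1 hX.
exists m, x; split=> //; first by rewrite -natrM ler_nat.
move=> f Xf; have [mf sup_le int_le] := hx f Xf.
set A := sample_norm2 x f; have A0 : 0 <= A by exact: sqrtr_ge0.
rewrite sample_norm2_sq // -/A in int_le sup_le.
have {}m7 : m%:R <= 7 * N%:R :> R by rewrite -natrM ler_nat.
have Npos : 0 < N%:R :> R by rewrite ltr0n.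
have [Az|An0] := eqVneq A 0.
  rewrite Az mulr0; apply: luxemburg_norm_eq0; first exact: Phi_at0.
  move=> y Oy; have := sup_le y Oy; rewrite Az expr0n mulr0 => le0.
  by apply/eqP; rewrite -sqrf_eq0 eq_le le0 sqr_ge0.
have Apos : 0 < A by rewrite lt_def An0.
have Lpos : 0 < L by apply: lt_le_trans L1.
apply: (@le_trans _ _ (4 * L * A)%:E); last by rewrite lee_fin ler_wpM2r.
apply: luxemburg_norm_le; first by rewrite !mulr_gt0.
pose h y := modulus (f y) / (4 * A).
have hE y : modulus (f y) / (4 * L * A) = h y / L.
  by rewrite /h; field; rewrite !gt_eqF.
under eq_integral do rewrite hE.
have h2 y : h y ^+ 2 = (16 * A ^+ 2)^-1 * modulus (f y) ^+ 2.
  by rewrite /h; field; rewrite gt_eqF.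
have c0 : 0 <= (16 * A ^+ 2)^-1 by rewrite invr_ge0 mulr_ge0 // sqr_ge0.
have mO := compact_measurable_borelRd cO.
apply: (Phi_modular_le1 (mu := mu) (t := Num.sqrt N%:R) p2 hP ha L1) => //.
- by rewrite sqrtr_gt0.
- by rewrite sqr_sqrtr // -mulrA.
- by apply: measurable_funM.
- move=> y Oy; have h0 : 0 <= h y by rewrite divr_ge0 ?modulus_ge0 // mulr_ge0.
  rewrite h0 /= -[h y]ger0_norm // -sqrtr_sqr ler_sqrt // h2.
  apply: le_trans (ler_wpM2l c0 (sup_le y Oy)) _.
  rewrite mulrC ler_pdivrMr ?mulr_gt0 ?exprn_gt0 //.
  have := exprn_gt0 2 Apos; nra.
- under eq_integral do rewrite h2 EFinM.
  rewrite ge0_integralZl_EFin //; last first.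
  + by apply/measurable_EFinP; exact: measurable_funX.
  + by move=> y _; rewrite lee_fin sqr_ge0.
  have N2 : 0 < N%:R / 2 :> R by rewrite divr_gt0.
  apply: (@le_trans _ _ ((16 * A ^+ 2)^-1%:E * ((N%:R / 2)^-1%:E * (m%:R * A ^+ 2)%:E))%E).
    apply: lee_pmul => //; first by rewrite integral_ge0 // => y _; rewrite lee_fin sqr_ge0.
    by rewrite lee_pdivlMl.
  rewrite -!EFinM lee_fin.
  have -> : (16 * A ^+ 2)^-1 * ((N%:R / 2)^-1 * (m%:R * A ^+ 2)) = m%:R / (8 * N%:R).
    by field; rewrite !gt_eqF.
  rewrite ler_pdivrMr ?mulr_gt0 // mul1r; apply: le_trans m7 _.
  by rewrite ler_pM2r // ler_nat.
Qed.

(** Since [p >= 2], the function [Phi (sqrt t) / t] is almost increasing, with the same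
constant. *)
Lemma aInc_ratio (R : realType) (Phi : R -> R) (p a : R) (M N : nat) :
  2 <= p -> Phi_function Phi -> aInc_with Phi p a -> (0 < M)%N -> (M <= N)%N ->
  Phi (Num.sqrt M%:R) / M%:R <= a * (Phi (Num.sqrt N%:R) / N%:R).
Proof.
move=> p2 hP ha M0 MN.
have Mpos : 0 < M%:R :> R by rewrite ltr0n.
have Npos : 0 < N%:R :> R by rewrite ltr0n (leq_trans M0).
have sMN : Num.sqrt M%:R <= Num.sqrt N%:R :> R by rewrite ler_sqrt ?ler_nat // ltW.
have sN : 0 < Num.sqrt N%:R :> R by rewrite sqrtr_gt0.
have := Phi_scaled_le p2 hP ha (lexx 1) sN (sqrtr_ge0 _) sMN.
rewrite powR1 !divr1 expr_div_n !sqr_sqrtr ?ler0n // => h.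
rewrite ler_pdivrMr //; apply: le_trans h _.
by rewrite le_eqVlt; apply/orP; left; apply/eqP; field; rewrite gt_eqF.
Qed.

(** Take [L^p = K r] with [K = a^2 (1 + 1 / q)], [q = Phi (sqrt M) / M] and
[r = Phi (sqrt N) / N].  The term [a^2 r] gives [L^p >= a r], and [q <= a r] gives
[a^2 r / q >= a >= 1], hence [L >= 1]. *)
Lemma sampling_bound_constant (R : realType) (Phi : R -> R) (p a : R) (M N : nat) :
  2 <= p -> Phi_function Phi -> aInc_with Phi p a ->
  (0 < M)%N -> (M <= N)%N -> 0 < Phi (Num.sqrt M%:R) ->
  sampling_bound Phi p 7
    (4 * (a ^+ 2 * (1 + (Phi (Num.sqrt M%:R) / M%:R)^-1)) `^ p^-1) N.
Proof.
move=> p2 hP ha M0 MN PM; have N0 := leq_trans M0 MN; have a1 := proj1 ha.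
have p0 : 0 < p by apply: lt_le_trans p2.
set q := Phi (Num.sqrt M%:R) / M%:R; set r := Phi (Num.sqrt N%:R) / N%:R.
have q0 : 0 < q by rewrite divr_gt0 // ltr0n.
have qr : q <= a * r by exact: (aInc_ratio p2 hP ha M0 MN).
have r0 : 0 < r by rewrite -(pmulr_rgt0 _ (lt_le_trans ltr01 a1)); apply: lt_le_trans qr.
have iq0 : 0 < q^-1 by rewrite invr_gt0.
set K := a ^+ 2 * (1 + q^-1).
have K0 : 0 <= K by rewrite mulr_ge0 ?sqr_ge0 // addr_ge0 // ltW.
have Kr : 1 <= K * r.
  have : 1 <= q^-1 * (a * r) by rewrite mulrC ler_pdivlMr // mul1r.
  rewrite /K; have : 0 <= a * r by rewrite mulr_ge0 ?ltW // (lt_le_trans _ a1).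
  set s := q^-1 * _.
  have -> : a ^+ 2 * (1 + q^-1) * r = a * (a * r) + a * s by rewrite /s; ring.
  nra.
apply: (sampling_bound_scale (L := (K * r) `^ p^-1) p2 hP ha N0).
- by rewrite -[leLHS](powRr0 (K * r)) ler_powR // invr_ge0 ltW.
- rewrite -powRrM mulVf ?gt_eqF // powRr1; last by rewrite mulr_ge0 // ltW.
  rewrite -/r; apply: ler_wpM2r; first exact: ltW.
  by rewrite /K; nra.
- by rewrite powRM // ?mulrA // ltW.
Qed.

(* If Phi (sqrt N) = 0 the asserted bound reads luxemburg_norm = 0, which
   fails in general; the inequality 0 < Phi (sqrt N) excludes only this case and follows
   from 0 < Phi 1, which is implicit in the explicit formula for c2. *)
Theorem corollary5p10 (R : realType) :
  exists c1 C : R, 0 < c1 /\ 1 <= C /\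
  forall (p : R) (Phi : R -> R), 2 <= p -> Phi_function Phi -> aInc Phi p ->
    (exists c2 : R, 0 < c2 /\
      forall N : nat, (0 < N)%N -> 0 < Phi (Num.sqrt N%:R) ->
        sampling_bound Phi p c1 c2 N) /\
    (forall a : R, aInc_with Phi p a -> 0 < Phi 1 ->
      forall N : nat, (0 < N)%N ->
        sampling_bound Phi p c1
          (C * a `^ (2 / p) * (1 + (Phi 1)^-1) `^ p^-1) N).
Proof.
exists 7, 4; split; first by []; split; first by rewrite ler1n.
move=> p Phi p2 hP [a ha]; split; last first.
  move=> {a ha} a ha P1 N N0; have a1 := proj1 ha.
  have -> : 4 * a `^ (2 / p) * (1 + (Phi 1)^-1) `^ p^-1 =
      4 * (a ^+ 2 * (1 + (Phi (Num.sqrt 1%:R) / 1%:R)^-1)) `^ p^-1.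
    (* the case M = 1 of the general constant *)
    rewrite sqrtr1 divr1 powRM ?sqr_ge0 // ?addr_ge0 ?invr_ge0 1?ltW //.
    by rewrite powRrM powR_mulrn ?mulrA // (le_trans ler01).
  by apply: sampling_bound_constant; rewrite ?sqrtr1.
(* M is the least positive integer at which Phi (sqrt M) is positive; if there is
   none, no N is concerned and any constant will do. *)
have [[N0 [N0pos PN0]]|no] :=
    pselect (exists N, (0 < N)%N /\ 0 < Phi (Num.sqrt N%:R)); last first.
  by exists 1; split=> // N N0 PN; case: no; exists N.
have ex : exists N, (0 < N)%N && (0 < Phi (Num.sqrt N%:R)).
  by exists N0; apply/andP.
case: (ex_minnP ex) => M /andP[M0 PM] Mmin; have a1 := proj1 ha.
exists (4 * (a ^+ 2 * (1 + (Phi (Num.sqrt M%:R) / M%:R)^-1)) `^ p^-1); split.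
  rewrite mulr_gt0 // powR_gt0 // mulr_gt0 ?exprn_gt0 ?(lt_le_trans ltr01 a1) //.
  by rewrite ltr_pwDl // invr_ge0 divr_ge0 // ltW.
move=> N Npos PN; apply: sampling_bound_constant => //.
by apply: Mmin; rewrite Npos.
Qed.
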